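(* For arbitrary augmented posets $A_{\mathcal{X}}$ and $B_{\mathcal{Y}}$, the map $\otimes:A\times B\to A_{\mathcal{X}}\otimes B_{\mathcal{Y}}$, $(x,y)\mapsto x\otimes y$, is universal among all $\mathcal{X}\mathcal{Y}$-bimorphisms into complete lattices. Thus, $\otimes$ is an $\mathcal{X}\mathcal{Y}$-bimorphism, and for any complete lattice $C$ and any $\mathcal{X}\mathcal{Y}$-bimorphism $f:A\times B\to C$, there is a unique join-preserving map $f^{\vee}:A_{\mathcal{X}}\otimes B_{\mathcal{Y}}\to C$ with $f(x,y)=f^{\vee}(x\otimes y)$ for all $(x,y)\in A\times B$.
   Context: An augmented poset $A_{\mathcal{X}}=(A,\mathcal{X})$ is a poset $A$ with a collection $\mathcal{X}$ of subsets of $A$. For $X\subseteq A$, $\Delta X=\bigcap\{\downarrow a: X\subseteq\downarrow a\}$ (intersection over all principal ideals containing $X$; $A$ if there are none). An $\mathcal{X}$-ideal is a subset $I\subseteq A$ with $\Delta X\subseteq I$ for all $X\in\mathcal{X}\cup\{\{x\}:x\in A\}$ with $X\subseteq I$. A map from $A$ to a poset is $\mathcal{X}$-ideal continuous if all preimages of principal ideals are $\mathcal{X}$-ideals. $A_{\mathcal{X}}\otimes B_{\mathcal{Y}}$ is the complete lattice, ordered by inclusion, of all $\mathcal{X}\mathcal{Y}$-tensors, i.e. subsets $T\subseteq A\times B$ such that each $\{y:(x,y)\in T\}$ ($x\in A$) is a $\mathcal{Y}$-ideal of $B$ and each $\{x:(x,y)\in T\}$ ($y\in B$) is an $\mathcal{X}$-ideal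 of $A$; $x\otimes y$ is the least $\mathcal{X}\mathcal{Y}$-tensor containing $(x,y)$. For a complete lattice $C$, a map $f:A\times B\to C$ is an $\mathcal{X}\mathcal{Y}$-bimorphism if each $A\to C$, $x\mapsto f(x,y)$ is $\mathcal{X}$-ideal continuous and each $B\to C$, $y\mapsto f(x,y)$ is $\mathcal{Y}$-ideal continuous. Join-preserving means preserving arbitrary joins (including the empty one). *)

(* Defs.v *)
From HB Require Import structures.
From mathcomp Require Import all_boot all_order.
From mathcomp Require Import boolp classical_sets.

Set Implicit Arguments.
Unset Strict Implicit.
Unset Printing Implicit Defensive.

Import Order.TTheory.
Local Open Scope order_scope.
Local Open Scope classical_set_scope.

HB.mixin Record POrder_isCompleteLattice (d : Order.disp_t) T
    of Order.POrder d T := {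
  exists_supremum : forall S : set T, supremums S !=set0;
  exists_infimum : forall S : set T, infimums S !=set0
}.

#[short(type="completeLatticeType")]
HB.structure Definition CompleteLattice (d : Order.disp_t) :=
  {T of POrder_isCompleteLattice d T & Order.POrder d T}.

(* On complete lattices this says g (\/ S) = \/ (g @` S); S may be empty. *)
Definition join_preserving (dL dC : Order.disp_t) (L : completeLatticeType dL)
    (C : completeLatticeType dC) (g : L -> C) : Prop :=
  forall (S : set L) (s : L), supremums S s -> supremums (g @` S) (g s).

Section AugmentedPoset.
Context (d : Order.disp_t) (A : porderType d).

Definition principal_ideal (a : A) : set A := [set x | x <= a].

(* If no principal ideal contains Z, the intersection is setT. *)
Definition cut_closure (Z : set A) : set A :=
  \bigcap_(a in [set a | Z `<=` principal_ideal a]) principal_ideal a.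

(* An augmented poset is a poset A together with a family X : set (set A). *)
Definition augmented_ideal (X : set (set A)) (I : set A) : Prop :=
  forall Z, (X `|` [set [set x] | x in [set: A]]) Z ->
    Z `<=` I -> cut_closure Z `<=` I.

End AugmentedPoset.

Definition ideal_continuous (dA dP : Order.disp_t) (A : porderType dA)
    (P : porderType dP) (X : set (set A)) (f : A -> P) : Prop :=
  forall p : P, augmented_ideal X (f @^-1` principal_ideal p).

Definition bimorphism (dA dB dC : Order.disp_t) (A : porderType dA)
    (B : porderType dB) (C : completeLatticeType dC)
    (X : set (set A)) (Y : set (set B)) (f : A * B -> C) : Prop :=
  (forall y : B, ideal_continuous X (fun x => f (x, y))) /\
  (forall x : A, ideal_continuous Y (fun y => f (x, y))).

Section TensorProduct.
Context (dA dB : Order.disp_t) (A : porderType dA) (B : porderType dB).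
Context (X : set (set A)) (Y : set (set B)).

Definition is_tensor (T : set (A * B)) : Prop :=
  (forall x : A, augmented_ideal Y [set y | T (x, y)]) /\
  (forall y : B, augmented_ideal X [set x | T (x, y)]).

Record tensor := Tensor {
  tensor_set :> set (A * B);
  tensor_setP : `[< is_tensor tensor_set >]
}.

HB.instance Definition _ := [isSub for tensor_set].
HB.instance Definition _ := [Choice of tensor by <:].
(* Tensors are ordered by inclusion, the order of set (A * B). *)
HB.instance Definition _ :=
  [SubChoice_isSubPOrder of tensor by <: with set_display].

Lemma tensor_leE (T U : tensor) : (T <= U) = (T `<=` U) :> Prop.
Proof. by rewrite -subsetEset. Qed.

Lemma is_tensor_bigcap (F : set (set (A * B))) :
  (forall T, F T -> is_tensor T) -> is_tensor (\bigcap_(T in F) T).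
Proof.
move=> FT; split=> [x|y] Z XZ ZI z Dz T FTT.
- by have [+ _] := FT _ FTT; move=> /(_ x Z XZ); apply=> // w /ZI; apply.
- by have [_] := FT _ FTT; move=> /(_ y Z XZ); apply=> // w /ZI; apply.
Qed.

Lemma is_tensor_smallest (G : set (A * B)) :
  is_tensor (smallest is_tensor G).
Proof. by apply: is_tensor_bigcap => T []. Qed.

Definition tensor_hull (G : set (A * B)) : tensor :=
  Tensor (asboolT (is_tensor_smallest G)).

Definition tens (x : A) (y : B) : tensor := tensor_hull [set (x, y)].

Lemma tensor_exists_supremum (S : set tensor) : supremums S !=set0.
Proof.
exists (tensor_hull (\bigcup_(T in S) T)); split=> [T ST|U ubU].
- rewrite tensor_leE => p Tp; apply: sub_gen_smallest.
  by exists T.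
- rewrite tensor_leE; apply: smallest_sub; first exact/asboolP/tensor_setP.
  by move=> p [T /ubU]; rewrite tensor_leE; apply.
Qed.

Lemma tensor_exists_infimum (S : set tensor) : infimums S !=set0.
Proof.
have capT : is_tensor (\bigcap_(T in [set tensor_set U | U in S]) T).
  by apply: is_tensor_bigcap => _ [U _ <-]; exact/asboolP/tensor_setP.
exists (Tensor (asboolT capT)); split=> [T ST|U lbU].
- by rewrite tensor_leE => p; apply; exists T.
- by rewrite tensor_leE => p Up _ [T /lbU + <-]; rewrite tensor_leE; apply.
Qed.

HB.instance Definition _ := POrder_isCompleteLattice.Build _ tensor
  tensor_exists_supremum tensor_exists_infimum.

End TensorProduct.

(* Main.v *)
Require Import Defs.
From HB Require Import structures.
From mathcomp Require Import all_boot all_order.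
From mathcomp Require Import boolp classical_sets.

Set Implicit Arguments.
Unset Strict Implicit.
Unset Printing Implicit Defensive.

(** The tensor [tens X Y x y] lies below [T] exactly when [T] contains [(x, y)].
Two consequences follow. First, the ideals required for [tens] to be a
bimorphism are literally the slices of tensors. Second, every tensor [T] is the
join of the elements [tens X Y x y] with [(x, y)] in [T], so a join-preserving
map is determined by its values on these elements.

Existence rests on a Galois connection. A map [f] is a bimorphism exactly when
each sublevel set [{p | f p <= c}] is a tensor. Hence
[c |-> {p | f p <= c}] is a map from [C] to the tensors, and its lower adjoint
[T |-> \/ (f @` T)] is the required extension: lower adjoints preserve joins,
and [tens X Y x y] is sent below [c] exactly when [(x, y)] belongs to the
sublevel set of [c], that is, when [f (x, y) <= c]. *)

Import Order.TTheory.
Local Open Scope order_scope.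
Local Open Scope classical_set_scope.

(** In this form a supremum is a representing element, so that joins can be
handled by chains of equivalences. *)
Lemma supremumsP (d : Order.disp_t) (P : porderType d) (S : set P) (s : P) :
  supremums S s <-> forall c, s <= c <-> ubound S c.
Proof.
split=> [[ubs leasts] c|sP].
  split=> [sc x Sx|]; last exact: leasts.
  exact: le_trans (ubs x Sx) sc.
by split=> [|c /sP]; first by apply/sP.
Qed.

Lemma supremums_unique (d : Order.disp_t) (P : porderType d) (S : set P)
    (s t : P) : supremums S s -> supremums S t -> s = t.
Proof.
by move=> [ubs leasts] [ubt leastt]; apply: le_anti; rewrite leasts ?leastt.
Qed.

Lemma lower_adjoint_join_preserving (dL dC : Order.disp_t)
    (L : completeLatticeType dL) (C : completeLatticeType dC)
    (g : L -> C) (h : C -> L) :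
  (forall T c, g T <= c <-> T <= h c) -> join_preserving g.
Proof.
move=> adj S s /supremumsP sP; apply/supremumsP => c.
rewrite adj sP; split=> [ubS _ [T ST <-]|ubgS T ST].
  by apply/adj; exact: ubS.
by apply/adj; apply: ubgS; exists T.
Qed.

Section TensorUniversality.
Context (dA dB : Order.disp_t) (A : porderType dA) (B : porderType dB).
Context (X : set (set A)) (Y : set (set B)).

Lemma tens_le (x : A) (y : B) (T : tensor X Y) :
  tens X Y x y <= T <-> tensor_set T (x, y).
Proof.
rewrite tensor_leE; split=> [|Txy]; first by apply; exact: sub_gen_smallest.
apply: smallest_sub; first exact/asboolP/tensor_setP.
by move=> _ ->.
Qed.

Lemma bimorphism_tens : bimorphism X Y (fun p : A * B => tens X Y p.1 p.2).
Proof.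
split=> [y|x] T; have /asboolP[slY slX] := tensor_setP T.
- suff -> : (fun x => tens X Y x y) @^-1` principal_ideal T =
            [set x | tensor_set T (x, y)] by exact: slX.
  by apply/seteqP; split=> x /tens_le.
- suff -> : (fun y => tens X Y x y) @^-1` principal_ideal T =
            [set y | tensor_set T (x, y)] by exact: slY.
  by apply/seteqP; split=> y /tens_le.
Qed.

Lemma tensor_join_tens (T : tensor X Y) :
  supremums [set tens X Y p.1 p.2 | p in tensor_set T] T.
Proof.
apply/supremumsP => U; rewrite tensor_leE; split=> [TU _ [[x y] Txy <-]|ubU].
  exact/tens_le/TU.
by move=> [x y] Txy; apply/tens_le/ubU; exists (x, y).
Qed.

Section Extension.
Context (dC : Order.disp_t) (C : completeLatticeType dC) (f : A * B -> C).
Context (bif : bimorphism X Y f).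

Lemma is_tensor_sublevel (c : C) : is_tensor X Y (f @^-1` principal_ideal c).
Proof. by split=> [x|y]; [exact: bif.2|exact: bif.1]. Qed.

Definition sublevel_tensor (c : C) : tensor X Y :=
  Tensor (asboolT (is_tensor_sublevel c)).

Definition tensor_extension (T : tensor X Y) : C :=
  projT1 (cid (exists_supremum (f @` tensor_set T))).

Lemma tensor_extension_adjoint (T : tensor X Y) (c : C) :
  tensor_extension T <= c <-> T <= sublevel_tensor c.
Proof.
rewrite /tensor_extension; case: cid => s /= /supremumsP ->.
rewrite tensor_leE; split=> [ubc p Tp|Tc _ [p Tp <-]]; last exact: Tc.
by apply: ubc; exists p.
Qed.

Lemma tensor_extension_tens (x : A) (y : B) :
  f (x, y) = tensor_extension (tens X Y x y).
Proof.
have extP c : tensor_extension (tens X Y x y) <= c <-> f (x, y) <= c.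
  by rewrite tensor_extension_adjoint tens_le.
by apply: le_anti; apply/andP; split; apply/extP.
Qed.

End Extension.

Lemma join_preserving_tens_inj (dC : Order.disp_t) (C : completeLatticeType dC)
    (g h : tensor X Y -> C) :
  join_preserving g -> join_preserving h ->
  (forall x y, g (tens X Y x y) = h (tens X Y x y)) -> g = h.
Proof.
move=> gj hj gh; apply/funext => T.
have eqim : g @` [set tens X Y p.1 p.2 | p in tensor_set T] =
            h @` [set tens X Y p.1 p.2 | p in tensor_set T].
  by apply: eq_imagel => _ [p _ <-]; exact: gh.
have gT := gj _ _ (tensor_join_tens T); rewrite eqim in gT.
exact: supremums_unique gT (hj _ _ (tensor_join_tens T)).
Qed.

End TensorUniversality.

Local Close Scope classical_set_scope.
Local Close Scope order_scope.

Theorem corollary5p1 (dA dB : Order.disp_t) (A : porderType dA)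
    (B : porderType dB) (X : set (set A)) (Y : set (set B)) :
  bimorphism X Y (fun p : A * B => tens X Y p.1 p.2) /\
  forall (dC : Order.disp_t) (C : completeLatticeType dC) (f : A * B -> C),
    bimorphism X Y f ->
    exists! g : tensor X Y -> C,
      join_preserving g /\ forall (x : A) (y : B), f (x, y) = g (tens X Y x y).
Proof.
split=> [|dC C f bif]; first exact: bimorphism_tens.
have ext_join : join_preserving (tensor_extension (X := X) (Y := Y) f).
  exact: lower_adjoint_join_preserving (tensor_extension_adjoint bif).
exists (tensor_extension f); split=> [|g [gj fg]].
  by split=> // x y; exact: tensor_extension_tens.
apply: join_preserving_tens_inj => // x y.
by rewrite -fg -(tensor_extension_tens bif).
Qed.
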